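(* Let $\Omega$ and $\Omega'$ be compact Hausdorff spaces and let $1\le q\le\infty$. Let $\mathcal{B}$ be a two-sided reproducing kernel Banach space of functions on $\Omega$ with two-sided reproducing kernel $K\in C(\Omega\times\Omega')$ such that the map $y\mapsto K(\cdot,y)$ (from $\Omega'$ to $\mathcal{B}$) is continuous on $\Omega'$ and the map $x\mapsto\|K(x,\cdot)\|_{\mathcal{B}'}$ belongs to $L_q(\Omega)$. If the operator $I_K^*:\mathcal{M}(\Omega')\to\mathcal{M}(\Omega)$, $$(I_K^*\nu')(A):=\int_A\mu(dx)\int_{\Omega'}K(x,y)\,\nu'(dy)\qquad\text{for all Borel sets }A\subseteq\Omega,$$ is injective, then the dual space $\mathcal{B}'$ has the universal approximation property, i.e. for any $\epsilon>0$ and any $g\in C(\Omega')$ there exists $s\in\mathcal{B}'$ with $\|g-s\|_\infty\le\epsilon$.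
   Context: $\Omega,\Omega'$ are equipped with regular Borel measures $\mu,\mu'$; $L_q(\Omega)$ is the Lebesgue space with respect to $\mu$. $L_0(X)$ denotes the set of real-valued measurable functions on $X$ (genuine functions). $C(X)$ is the Banach space of real continuous functions on the compact space $X$ with the uniform norm $\|\cdot\|_\infty$, and $\mathcal{M}(X)$ is the space of regular signed Borel measures on $X$ with the variation norm. Two-sided reproducing kernel Banach space: let $K\in L_0(\Omega\times\Omega')$ and let $\mathcal{B}$ be a Banach space consisting of functions in $L_0(\Omega)$ whose continuous dual $\mathcal{B}'$ is isometrically isomorphic to a normed space $\mathcal{F}$ consisting of functions in $L_0(\Omega')$; $\mathcal{F}$ is fixed and identified with $\mathcal{B}'$ (so elements of $\mathcal{B}'$ are functions on $\Omega'$), and $\langle f,G\rangle_{\mathcal{B}}:=G(f)$. $\mathcal{B}$ is a two-sided reproducing kernel Banach space with two-sided reproducing kernel $K$ if (i) $K(x,\cdot)\in\mathcal{F}\cong\mathcal{B}'$ for each $x\in\Omega$; (ii) $\langle f,K(x,\cdot)\rangle_{\mathcal{B}}=f(x)$ for all $f\in\mathcal{B}$, $x\in\Omega$; (iii) $K(\cdot,y)\in\mathcal{B}$ for each $y\in\Omega'$; (iv) $\langle K(\cdot,y),g\rangle_{\mathcal{B}}=g(y)$ for all $g\in\mathcal{F}$, $y\in\Omega'$. *)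

(* Defs.v *)
From HB Require Import structures.
From mathcomp Require Import all_boot all_order all_algebra.
From mathcomp Require Import all_classical all_reals all_analysis.

Set Implicit Arguments.
Unset Strict Implicit.
Unset Printing Implicit Defensive.

Import Order.TTheory GRing.Theory Num.Theory.
Import numFieldNormedType.Exports.

Local Open Scope classical_set_scope.
Local Open Scope ring_scope.

(* [measurableType] requires a point, hence [ptopologicalType]. *)
Notation borel T := (g_sigma_algebraType (@open T)).

Section RegularMeasures.
Context {R : realType} {T : ptopologicalType}.

(* Finite on compact sets, outer regular by open sets and inner regular by
   compact sets, on every Borel set. *)
Definition regular_measure (mu : set (borel T) -> \bar R) : Prop :=
  [/\ forall C : set T, compact C -> (mu C < +oo)%E,
      forall A : set (borel T), measurable A ->
        mu A = ereal_inf [set mu U | U in [set U : set T | open U /\ A `<=` U]]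
    & forall A : set (borel T), measurable A ->
        mu A =
        ereal_sup [set mu C | C in [set C : set T | compact C /\ C `<=` A]]].

End RegularMeasures.

(* A Hahn decomposition is chosen once and for all; by
   [Hahn_decomposition_uniq] the Jordan parts do not depend on the choice on
   measurable sets. *)
Section SignedMeasures.
Context d {T : measurableType d} {R : realType}.
Variable nu : {charge set T -> \bar R}.

Definition hahn_P : set T := projT1 (cid (Hahn_decomposition nu)).
Definition hahn_N : set T :=
  projT1 (cid (projT2 (cid (Hahn_decomposition nu)))).
Definition hahn_PN : hahn_decomposition nu hahn_P hahn_N :=
  projT2 (cid (projT2 (cid (Hahn_decomposition nu)))).

Definition total_variation : set T -> \bar R := charge_variation hahn_PN.

Definition charge_integral (f : T -> R) : R :=
  \int[jordan_pos hahn_PN]_x f x - \int[jordan_neg hahn_PN]_x f x.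

End SignedMeasures.

(* Membership in the space M(T) of regular signed Borel measures; charges are
   finite-valued by definition. *)
Definition regular_charge {R : realType} {T : ptopologicalType}
    (nu : {charge set (borel T) -> \bar R}) : Prop :=
  regular_measure (total_variation nu).

(* Only the set function is built: for continuous [K], compact spaces and a
   regular [mu], the inner integral is continuous in [x], the outer one is
   absolutely convergent and the result is a regular charge. *)
Definition IKstar {R : realType} {S T : ptopologicalType}
    (mu : {measure set (borel S) -> \bar R}) (K : S * T -> R)
    (nu : {charge set (borel T) -> \bar R}) (A : set (borel S)) : \bar R :=
  (\int[mu]_(x in A) (charge_integral nu (fun y => K (x, y)))%:E)%E.

(* A charge carries irrelevant values on non-measurable sets, so elements of
   M(S) and M(T) are compared on Borel sets only. *)
Definition IKstar_injective {R : realType} {S T : ptopologicalType}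
    (mu : {measure set (borel S) -> \bar R}) (K : S * T -> R) : Prop :=
  forall nu1 nu2 : {charge set (borel T) -> \bar R},
    regular_charge nu1 -> regular_charge nu2 ->
    (forall A : set (borel S), measurable A ->
       IKstar mu K nu1 A = IKstar mu K nu2 A) ->
    forall A : set (borel T), measurable A -> nu1 A = nu2 A.

Definition dual_norm {R : realType} {V : normedModType R} (G : V -> R) : R :=
  sup [set `|G v| | v in [set v : V | `|v| <= 1]].

(* [Phi] is an isometric isomorphism from [F] onto the continuous dual of [V];
   injectivity follows from the isometry. *)
Definition dual_isometry {R : realType} {V F : normedModType R}
    (Phi : F -> V -> R) : Prop :=
  [/\ forall v : V, scalar (Phi^~ v),
      forall g : F, scalar (Phi g) /\ continuous (Phi g),
      forall G : V -> R, scalar G -> continuous G -> exists g : F, Phi g = G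
    & forall g : F, dual_norm (Phi g) = `|g|].

(* [V] consists of functions in L_0(X): a vector [v] is identified with the
   function [ev v], the vector operations being pointwise. *)
Definition space_of_functions d {X : measurableType d} {R : realType}
    {V : lmodType R} (ev : V -> X -> R) : Prop :=
  [/\ forall x : X, scalar (ev^~ x),
      injective ev
    & forall v : V, measurable_fun [set: X] (ev v)].

(* Two-sided reproducing kernel Banach spaces with kernel [K]. The vectors
   [rkbs_row x] and [rkbs_col y] are K(x,.) and K(.,y) seen in the dual and in
   the space; they are unique because the evaluations are injective. *)
Record two_sided_rkbs d d' (X : measurableType d) (Y : measurableType d')
    (R : realType) (K : X * Y -> R) := TwoSidedRKBS {
  rkbs_space : completeNormedModType R;
  rkbs_ev : rkbs_space -> X -> R;
  rkbs_dual : normedModType R;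
  rkbs_dual_ev : rkbs_dual -> Y -> R;
  rkbs_iso : rkbs_dual -> rkbs_space -> R;
  rkbs_row : X -> rkbs_dual;
  rkbs_col : Y -> rkbs_space;
  rkbs_kernel_measurable : measurable_fun [set: X * Y] K;
  rkbs_space_functions : space_of_functions rkbs_ev;
  rkbs_dual_functions : space_of_functions rkbs_dual_ev;
  rkbs_isoP : dual_isometry rkbs_iso;
  rkbs_rowE : forall x, rkbs_dual_ev (rkbs_row x) = (fun y => K (x, y));
  rkbs_reproducing : forall f x, rkbs_iso (rkbs_row x) f = rkbs_ev f x;
  rkbs_colE : forall y, rkbs_ev (rkbs_col y) = (fun x => K (x, y));
  rkbs_dual_reproducing :
    forall g y, rkbs_iso g (rkbs_col y) = rkbs_dual_ev g y
}.

Definition uniform_norm {R : realType} {T : Type} (f : T -> R) : \bar R :=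
  ereal_sup [set (`|f y|)%:E | y in [set: T]].

(* Main.v *)
(* A failure of density is turned into two finite regular measures on Omega'
   that have the same integral against every element of the dual but not
   against g; since K(x,.) lies in the dual, IK* takes the same value on both,
   and injectivity is violated.

   Metrizability of Omega' makes the Riesz representation theorem elementary.
   Dirac measures and the injectivity of IK* show that y |-> K(.,y) is
   injective, so Omega' embeds in the Banach space and is the image of the
   Cantor space C under a continuous map pi. On pairs of bounded functions on
   C, the functional (u, v) |-> max (sup u) (sup v) is sublinear and takes the
   value |h|_oo at (h o pi, - h o pi). By the Mazur-Orlicz form of Hahn-Banach
   it dominates a linear, hence positive, functional that is at least eps at g
   and vanishes on the dual. Each of its two components is a finitely additive
   measure on the clopen subsets of C, where compactness makes it
   sigma-additive; the Caratheodory extension, pushed forward by pi, is the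
   required measure. *)
Require Import Defs.
From HB Require Import structures.
From mathcomp Require Import all_boot all_order all_algebra.
From mathcomp Require Import all_classical all_reals all_analysis.
From mathcomp Require Import measurable_realfun lra.
Import Order.TTheory GRing.Theory Num.Theory.
Import numFieldNormedType.Exports.
Set Implicit Arguments.
Unset Strict Implicit.
Unset Printing Implicit Defensive.
Local Open Scope classical_set_scope.
Local Open Scope ring_scope.

(** * The Hahn-Banach theorem in Mazur-Orlicz form *)

Section MazurOrlicz.
Context {R : realType} {V : lmodType R}.
Implicit Types (p q : V -> R) (G : set (V * R)).

Definition sublinear p :=
  (forall u v, p (u + v) <= p u + p v) /\
  (forall c v, 0 <= c -> p (c *: v) = c * p v).

(** A pair [(v, a)] in [G] stands for the constraint [a <= L v] on the linear functional to be
    found. *)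
Definition convex_cone G :=
  [/\ G (0, 0), forall x y, G x -> G y -> G (x.1 + y.1, x.2 + y.2)
    & forall c x, 0 <= c -> G x -> G (c *: x.1, c * x.2)].

Lemma sublinear0 p : sublinear p -> p 0 = 0.
Proof. by case=> _ /(_ 0 0 (lexx 0)); rewrite scale0r mul0r. Qed.

Lemma sublinear_ge p v : sublinear p -> - p (- v) <= p v.
Proof.
move=> sp; have := sp.1 v (- v); rewrite subrr (sublinear0 sp); lra.
Qed.

(** The inequality for [c^-1] gives the reverse inequality for [c]. *)
Lemma sublinear_build p : p 0 = 0 ->
  (forall u v, p (u + v) <= p u + p v) ->
  (forall c v, 0 < c -> p (c *: v) <= c * p v) -> sublinear p.
Proof.
move=> p0 pD pZ; split=> // c v; rewrite le_eqVlt => /predU1P[<-|c0].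
  by rewrite scale0r mul0r.
apply/eqP; rewrite eq_le pZ//= -ler_pdivlMl//.
by rewrite -{1}[v](scalerK (lt0r_neq0 c0)) pZ// invr_gt0.
Qed.

(** The functional is [q v = inf (p (v + w) - a)] over the pairs [(w, a)] in [G]. Since
    [a <= p w <= p (- v) + p (v + w)], the infimum is at least [- p (- v)]; the pair [(w, a)] itself
    bounds [q (- w)] by [- a]. *)
Lemma sublinear_inf_cone p (G : set (V * R)) : sublinear p -> convex_cone G ->
  (forall x, G x -> x.2 <= p x.1) ->
  exists q, [/\ sublinear q, forall v, q v <= p v
    & forall x, G x -> q (- x.1) <= - x.2].
Proof.
move=> sp [G0 GD GZ] Gp; pose E v := [set p (v + x.1) - x.2 | x in G].
have Elb v x : G x -> - p (- v) <= p (v + x.1) - x.2.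
  move=> Gx; have := sp.1 (- v) (v + x.1); rewrite addKr.
  by have := Gp _ Gx; lra.
have Ei v : has_inf (E v).
  split; first by exists (p (v + 0) - 0), 0.
  by exists (- p (- v)) => _ [x Gx <-]; exact: Elb.
have Eub v x : G x -> inf (E v) <= p (v + x.1) - x.2.
  by move=> Gx; apply: ge_inf; [exact: (Ei v).2|exists x].
have Ege v c : (forall x, G x -> c <= p (v + x.1) - x.2) -> c <= inf (E v).
  by move=> H; apply: lb_le_inf; [exact: (Ei v).1|move=> _ [x Gx <-]; exact: H].
have Elt v e : 0 < e -> exists2 x, G x & p (v + x.1) - x.2 < inf (E v) + e.
  move=> e0; have := inf_adherent e0 (Ei v).
  by case=> _ [x Gx <-] ?; exists x.
exists (fun v => inf (E v)); split.
- apply: sublinear_build.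
  + apply/eqP; rewrite eq_le; apply/andP; split.
      by have := Eub 0 _ G0; rewrite addr0 (sublinear0 sp) subr0.
    apply: Ege => x Gx; rewrite add0r; have := Gp _ Gx; lra.
  + move=> u v; apply/ler_addgt0Pr => e e0.
    have e20 : 0 < e / 2 by rewrite divr_gt0.
    have [x Gx xlt] := Elt u _ e20; have [y Gy ylt] := Elt v _ e20.
    have := Eub (u + v) _ (GD _ _ Gx Gy); have := sp.1 (u + x.1) (v + y.1).
    rewrite addrACA /=; lra.
  + move=> c v c0; rewrite -ler_pdivrMl//; apply: Ege => x Gx.
    rewrite ler_pdivrMl// mulrBr -(sp.2 _ _ (ltW c0)) scalerDr.
    exact: (Eub (c *: v) _ (GZ _ _ (ltW c0) Gx)).
- by move=> v; have := Eub v _ G0; rewrite addr0 subr0.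
- move=> x Gx; have := Eub (- x.1) _ Gx; rewrite addNr (sublinear0 sp); lra.
Qed.

(** The infimum is taken pointwise. For subadditivity, take members of [A] nearly optimal at [u] and
    at [v]: the smaller of the two is nearly optimal at both. *)
Lemma sublinear_inf_chain p (A : set (V -> R)) : A !=set0 ->
  (forall q, A q -> sublinear q /\ (forall v, q v <= p v)) ->
  (forall q r, A q -> A r ->
    (forall v, q v <= r v) \/ (forall v, r v <= q v)) ->
  exists q, [/\ sublinear q, forall v, q v <= p v
    & forall r, A r -> forall v, q v <= r v].
Proof.
move=> [q0 Aq0] Ap Atot; pose E v := [set q v | q in A].
have Ei v : has_inf (E v).
  split; first by exists (q0 v), q0.
  exists (- p (- v)) => _ [q Aq <-]; have [sq qp] := Ap _ Aq.
  by apply: le_trans (sublinear_ge v sq); rewrite lerN2.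
have Eub v q : A q -> inf (E v) <= q v.
  by move=> Aq; apply: ge_inf; [exact: (Ei v).2|exists q].
have Ege v c : (forall q, A q -> c <= q v) -> c <= inf (E v).
  by move=> H; apply: lb_le_inf; [exact: (Ei v).1|move=> _ [x Gx <-]; exact: H].
have Elt v e : 0 < e -> exists2 q, A q & q v < inf (E v) + e.
  move=> e0; have := inf_adherent e0 (Ei v).
  by case=> _ [x Gx <-] ?; exists x.
exists (fun v => inf (E v)); split; last by move=> r Ar v; exact: Eub.
- apply: sublinear_build.
  + apply/eqP; rewrite eq_le; apply/andP; split.
      by have := Eub 0 _ Aq0; rewrite (sublinear0 (Ap _ Aq0).1).
    by apply: Ege => q /Ap[sq _]; rewrite (sublinear0 sq).
  + move=> u v; apply/ler_addgt0Pr => e e0.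
    have e20 : 0 < e / 2 by rewrite divr_gt0.
    have [x Gx xlt] := Elt u _ e20; have [y Gy ylt] := Elt v _ e20.
    case: (Atot _ _ Gx Gy) => H.
    * have := Eub (u + v) _ Gx; have := (Ap _ Gx).1.1 u v; have := H v; lra.
    * have := Eub (u + v) _ Gy; have := (Ap _ Gy).1.1 u v; have := H u; lra.
  + move=> c v c0; rewrite -ler_pdivrMl//; apply: Ege => q Aq.
    by rewrite ler_pdivrMl// -((Ap _ Aq).1.2 _ _ (ltW c0)); exact: Eub.
- by move=> v; exact: le_trans (Eub v _ Aq0) ((Ap _ Aq0).2 v).
Qed.

Lemma sublinear_minimal p : sublinear p ->
  exists q, [/\ sublinear q, forall v, q v <= p v
    & forall r, sublinear r -> (forall v, r v <= q v) -> r = q].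
Proof.
move=> sp; pose T := {q : V -> R | sublinear q /\ (forall v, q v <= p v)}.
(* The order is reversed, so that the maximal element given by Zorn's lemma is pointwise minimal. *)
pose below (a b : T) := `[< forall v, sval b v <= sval a v >].
have [//| | | |[q [sq qp]] qmin] := @Zorn T below.
- by move=> a; apply/asboolP.
- move=> a b c /asboolP ba /asboolP cb; apply/asboolP => v.
  exact: le_trans (cb v) (ba v).
- move=> [a Pa] [b Pb] /asboolP/= ba /asboolP/= ab.
  apply: eq_exist; apply/funext => v; apply/eqP.
  by rewrite eq_le ab ba.
- move=> A Atot; have [A0|/set0P[a0 Aa0]] := eqVneq A set0.
    have Pp : sublinear p /\ (forall v, p v <= p v) by split.
    by exists (exist _ p Pp) => s; rewrite A0.
  have [|_ [a Aa <-]|_ _ [a Aa <-] [b Ab <-]|q [sq qp qA]] :=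
      @sublinear_inf_chain p [set sval a | a in A].
  + by exists (sval a0), a0.
  + exact: (svalP a).
  + by case: (Atot _ _ Aa Ab) => /asboolP; [right|left].
  + exists (exist _ q (conj sq qp)) => s As; apply/asboolP => v /=.
    by apply: qA; exists s.
exists q; split=> // r sr rq.
have rp v : r v <= p v by exact: le_trans (rq v) (qp v).
have := qmin (exist _ r (conj sr rp)).
by move/(_ (asboolT rq)) => /(congr1 sval).
Qed.

(** First [p] is lowered to [p'] so that [p' (- v) <= - a] for [(v, a)] in [G]. A minimal sublinear
    functional below [p'] is linear, and linearity turns this bound into [a <= L v]. *)
Theorem mazur_orlicz p (G : set (V * R)) : sublinear p -> convex_cone G ->
  (forall x, G x -> x.2 <= p x.1) ->
  exists L : V -> R, [/\ scalar L, forall v, L v <= p v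
    & forall x, G x -> x.2 <= L x.1].
Proof.
move=> sp cG Gp; have [p' [sp' p'p p'G]] := sublinear_inf_cone sp cG Gp.
have [q [sq qp' qmin]] := sublinear_minimal sp'.
(* Lowering [q] along the ray through [v] gives a sublinear functional below
   [q], hence [q] itself by minimality; this bounds [q (- v)]. *)
have qN v : q (- v) = - q v.
  apply/eqP; rewrite eq_le.
  have := sublinear_ge (- v) sq; rewrite opprK => ->; rewrite andbT.
  pose H := [set x : V * R | exists2 t, 0 <= t & x = (t *: v, t * q v)].
  have cH : convex_cone H.
    split.
    - by exists 0 => //; rewrite scale0r mul0r.
    - move=> _ _ [s s0 ->] [t t0 ->]; exists (s + t); first exact: addr_ge0.
      by rewrite scalerDl mulrDl.
    - move=> c _ c0 [t t0 ->]; exists (c * t); first exact: mulr_ge0.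
      by rewrite -scalerA -mulrA.
  have [_ [t t0 ->]/=|r [sr rq rH]] := sublinear_inf_cone sq cH.
    by rewrite sq.2.
  rewrite -{1}(qmin _ sr rq).
  by apply: (rH (v, q v)); exists 1 => //; rewrite scale1r mul1r.
have qD u v : q (u + v) = q u + q v.
  apply/eqP; rewrite eq_le sq.1 /=.
  by have := sq.1 (- u) (- v); rewrite -opprD !qN; lra.
have qZ c v : q (c *: v) = c * q v.
  have [c0|/ltW c0] := leP 0 c; first exact: sq.2.
  by apply: oppr_inj; rewrite -qN -scaleNr sq.2 ?oppr_ge0// mulNr.
exists q; split.
- by move=> c u v; rewrite qD qZ.
- by move=> v; exact: le_trans (qp' v) (p'p v).
- move=> x Gx; have := p'G _ Gx; have := qp' (- x.1); rewrite qN; lra.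
Qed.

End MazurOrlicz.

(** * The vector space of bounded real functions *)

Section BoundedFunctions.
Context {T : Type} {R : realType}.

Definition bounded_functions : {pred T -> R} :=
  mem [set f : T -> R | exists M, forall x, `|f x| <= M].

Lemma bounded_functions_submod_closed : submod_closed bounded_functions.
Proof.
split=> [|a f g /set_mem[M fM] /set_mem[N gN]]; apply: mem_set.
  by exists 0 => x; rewrite normr0.
exists (`|a| * M + N) => x; apply: (le_trans (ler_normD _ _)).
by rewrite lerD// normrM ler_wpM2l.
Qed.

HB.instance Definition _ := GRing.isSubmodClosed.Build R (T -> R)
  bounded_functions bounded_functions_submod_closed.

(** No continuity is imposed: indicators must be members, so that a functional on this space yields
    a content by evaluation at them. *)
Record bfun := BFun {bfun_val :> T -> R; _ : bfun_val \in bounded_functions}.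

HB.instance Definition _ := [isSub for bfun_val].
HB.instance Definition _ := [Choice of bfun by <:].
HB.instance Definition _ := [SubChoice_isSubLmodule of bfun by <:].

Lemma bfun_bound (f : bfun) : exists M, forall x, `|f x| <= M.
Proof. by case: f => f /= /set_mem. Qed.

Lemma bfunDE (f g : bfun) x : (f + g) x = f x + g x. Proof. by []. Qed.
Lemma bfunZE c (f : bfun) x : (c *: f) x = c * f x. Proof. by []. Qed.
Lemma bfunNE (f : bfun) x : (- f) x = - f x. Proof. by []. Qed.

Lemma bfunP (f g : bfun) : (forall x, f x = g x) -> f = g.
Proof. by move=> fg; apply/val_inj/funext. Qed.

Definition mk_bfun (f : T -> R) (fM : exists M, forall x, `|f x| <= M) : bfun :=
  BFun (mem_set fM).

Lemma bounded_indic (A : set T) : exists M, forall x, `|(\1_A x : R)| <= M.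
Proof.
by exists 1 => x; rewrite indicE; case: (_ \in _); rewrite ?normr1 ?normr0.
Qed.

Definition bindic (A : set T) : bfun := mk_bfun (bounded_indic A).

Lemma bounded_mul (f g : bfun) : exists M, forall x, `|f x * g x| <= M.
Proof.
have [[M fM] [N gN]] := (bfun_bound f, bfun_bound g).
by exists (M * N) => x; rewrite normrM ler_pM.
Qed.

Definition bmul (f g : bfun) : bfun := mk_bfun (bounded_mul f g).

End BoundedFunctions.
Arguments bfun : clear implicits.

(** * Contents on the clopen algebra of a compact space *)

Section ClopenAlgebra.
Context {T : ptopologicalType}.

(** An alias, so that the algebra of clopen sets is not imposed on [T] itself. *)
Definition clopen_algebra : Type := T.

Definition clopen_display : measure_display. Proof. exact. Qed.

HB.instance Definition _ := Pointed.on clopen_algebra.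
HB.instance Definition _ := @isAlgebraOfSets.Build clopen_display clopen_algebra
  (@clopen T) clopen0 clopenU (fun A => clopenC A).

(** The union is closed, hence compact, and finitely many of the open sets [F n] cover it. A set
    with a larger index is disjoint from all of these, hence empty. *)
Lemma trivIset_clopen_eventually0 (F : (set T)^nat) : compact [set: T] ->
  (forall n, clopen (F n)) -> trivIset setT F -> clopen (\bigcup_n F n) ->
  exists N, forall n, (N <= n)%N -> F n = set0.
Proof.
move=> cT cF tF [_ cUF].
have : compact (\bigcup_n F n) by exact: subclosed_compact cUF cT _.
rewrite compact_cover => /(_ nat setT F)[n _|//|D _ UFD]; first exact: (cF n).1.
exists (\max_(i <- finmap.enum_fset D) i).+1%N => n Dn.
apply/seteqP; split=> // x Fnx.
have [m /= mD Fmx] := UFD x (ex_intro2 _ _ n I Fnx).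
have nm : n = m by apply: (tF n m) => //; exists x.
by move: Dn; rewrite ltnNge nm (leq_bigmax_seq m).
Qed.

(** By [trivIset_clopen_eventually0], sigma-additivity on the clopen algebra reduces to finite
    additivity, and the Caratheodory extension applies. The infimum formula is that of the outer
    measure; [clopen_approx] relies on it. *)
Lemma clopen_content_extension {R : realType} (m : set T -> R) :
  compact [set: T] -> (forall A, 0 <= m A) ->
  (forall A B, [disjoint A & B] -> m (A `|` B) = m A + m B) ->
  exists mu : {measure set (g_sigma_algebraType (@clopen T)) -> \bar R},
    (forall A, clopen A -> mu A = (m A)%:E) /\
    (forall A, mu A = ereal_inf
      [set \sum_(k <oo) (m (F k))%:E | F in
        [set F : (set T)^nat | (forall k, clopen (F k)) /\
                               A `<=` \bigcup_k F k]])%E.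
Proof.
move=> cT m0 mD.
have mset0 : m set0 = 0.
  by apply: (addrI (m set0)); rewrite -mD ?setU0 ?addr0//; apply/disj_setPS.
pose mu0 (A : set clopen_algebra) := (m A)%:E.
have sigma_mu0 : semi_sigma_additive mu0.
  move=> F cF tF cUF; have [N FN] := trivIset_clopen_eventually0 cT cF tF cUF.
  have sumE n : (\sum_(0 <= i < n) mu0 (F i))%E =
      mu0 (\big[setU/set0]_(0 <= i < n) F i).
    elim: n => [|n IH]; first by rewrite !big_nil /mu0 mset0.
    rewrite !big_nat_recr//= IH /mu0 -EFinD -mD//.
    rewrite big_mkord -bigcup_mkord; apply/disj_setPS => x [[i /= ni Fix] Fnx].
    by have := tF i n I I; move: ni => /[swap] -> //; [rewrite ltnn|exists x].
  apply: cvg_near_cst; exists N => // n /= Nn; rewrite sumE; congr mu0.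
  rewrite big_mkord -bigcup_mkord; apply/seteqP; split=> x [i _ Fix].
    by exists i.
  exists i => //=; rewrite ltnNge; apply/negP => ni.
  by move: Fix; rewrite FN// (leq_trans Nn).
have mu00 : mu0 set0 = 0%E by rewrite /mu0 mset0.
have mu0_ge0 A : (0 <= mu0 A)%E by rewrite lee_fin.
pose mu1 : {measure set clopen_algebra -> \bar R} :=
  HB.pack mu0 (isMeasure.Build _ _ _ mu0 mu00 mu0_ge0 sigma_mu0).
pose mu2 : {measure set (g_sigma_algebraType (@measurable _ clopen_algebra))
  -> \bar R} := measure_extension mu1.
exists mu2; split=> // A cA.
exact: (@measurable_mu_extE _ _ _ mu1).
Qed.

End ClopenAlgebra.

(** * Clopen sets, Borel sets and integrals on zero-dimensional compact spaces *)

Section ClopenGenerated.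

Lemma cantor_clopen_countable (R : realType) : countable (@clopen cantor_space).
Proof.
apply: clopen_countable; first exact: cantor_space_compact.
(* Second countability comes from a pseudometric: that of a countable product of copies of
   [bool]. *)
pose B : pseudoMetricType R := bool.
pose T : pseudoMetricType R := prod_topology (fun _ : nat => B).
pose T' : pseudoPMetricType R := HB.pack cantor_space (PseudoMetric.class T).
exact: (@compact_second_countable R T' cantor_space_compact).
Qed.

Lemma zero_dimensional_clopen_nbhs {T : ptopologicalType} (x : T) (U : set T) :
  compact [set: T] -> hausdorff_space T -> zero_dimensional T ->
  nbhs x U -> exists A, [/\ clopen A, A x & A `<=` U].
Proof.
move=> cT hT zT /(zero_dimensional_cvg hT zT cT)[A [Ax cA] AU].
by exists A.
Qed.

(** An open set is the union of the clopen sets inside it, and there are only countably many of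
    these. *)
Lemma open_g_sigma_clopen {T : ptopologicalType} (U : set T) :
  compact [set: T] -> hausdorff_space T -> zero_dimensional T ->
  countable (@clopen T) -> open U -> <<s @clopen T >> U.
Proof.
move=> cT hT zT cc oU.
have -> : U = \bigcup_(A in [set A | clopen A /\ A `<=` U]) A.
  apply/seteqP; split=> [x Ux|x [A [_ AU] /AU//]].
  have [A [cA Ax AU]] :=
    zero_dimensional_clopen_nbhs cT hT zT (open_nbhs_nbhs (conj oU Ux)).
  by exists A.
set D := [set A | _]; have : countable D.
  by apply: sub_countable cc; apply: subset_card_le => A [].
move=> /pfcard_geP[->|[h]]; first by rewrite bigcup_set0; exact: sigma_algebra0.
have -> : \bigcup_(A in D) A = \bigcup_n h n.
  apply/seteqP; split=> [x [A DA Ax]|x [n _ hx]].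
    by have [n _ hn] := @surj _ _ _ _ h _ DA; exists n; rewrite ?hn.
  by exists (h n) => //; exact: funS.
apply: (@bigcupT_measurable _ (g_sigma_algebraType (@clopen T))) => n.
by apply: sub_sigma_algebra; have [] : D (h n) by exact: funS.
Qed.

Lemma continuous_g_sigma_measurable {T : ptopologicalType} {R : realType}
    (G : set (set T)) (f : T -> R) : open `<=` <<s G >> -> continuous f ->
  measurable_fun [set: g_sigma_algebraType G] (f : g_sigma_algebraType G -> R).
Proof.
move=> oG cf; apply: (measurability _ (RGenOInfty.measurableE R)).
move=> _ [_ [a ->] <-]; rewrite setTI; apply: oG.
by move/continuousP : cf; apply; exact: interval_open.
Qed.

(* [Phi] and [Psi] share the bounds of [f] against [m] on every clopen set, and
   [f] is nearly constant on the pieces of a fine clopen partition. *)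
Lemma clopen_content_unique {T : ptopologicalType} {R : realType} (f : T -> R)
    (m Phi Psi : set T -> R) :
  compact [set: T] -> hausdorff_space T -> zero_dimensional T ->
  continuous f ->
  (forall A B, clopen A -> clopen B -> [disjoint A & B] ->
    [/\ m (A `|` B) = m A + m B, Phi (A `|` B) = Phi A + Phi B &
        Psi (A `|` B) = Psi A + Psi B]) ->
  (forall A a b, clopen A -> (forall x, A x -> a <= f x <= b) ->
    a * m A <= Phi A <= b * m A /\ a * m A <= Psi A <= b * m A) ->
  Phi setT = Psi setT.
Proof.
move=> cT hT zT cf add bnd.
pose good (e : R) A := `|Phi A - Psi A| <= e * m A.
have goodU e A B : clopen A -> clopen B -> [disjoint A & B] ->
    good e A -> good e B -> good e (A `|` B).
  move=> cA cB AB; rewrite /good; have [-> -> ->] := add A B cA cB AB.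
  by move=> /ler_normlP[? ?] /ler_normlP[? ?]; apply/ler_normlP; split; lra.
have goodT e : 0 < e -> good e setT.
  move=> e0.
  have loc x : exists U, [/\ clopen U, U x &
      forall A, clopen A -> A `<=` U -> good e A].
    have e20 : 0 < e / 2 by rewrite divr_gt0.
    have /cvgrPdist_lt/(_ _ e20) := cf x.
    move=> /(zero_dimensional_clopen_nbhs cT hT zT)[U [cU Ux Uf]].
    exists U; split=> // A cA AU.
    (* On [U] the function [f] stays within [e / 2] of [f x], so [Phi A] and [Psi A] lie in one
       interval of length [e * m A]. *)
    have [] := bnd A (f x - e / 2) (f x + e / 2) cA.
      by move=> y /AU/Uf /=; rewrite ltr_distlC => /andP[? ?]; lra.
    by move=> /andP[? ?] /andP[? ?]; apply/ler_normlP; split; lra.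
  pose U x := sval (cid (loc x)).
  have [cU Ux Ugood] : [/\ forall x, clopen (U x), forall x, U x x &
      forall x A, clopen A -> A `<=` U x -> good e A].
    by split=> x; rewrite /U; case: cid => V [].
  move: cT; rewrite compact_cover => /(_ T setT U)[x _|x _|D _ UD].
  - exact: (cU x).1.
  - by exists x.
  have : [set: T] `<=` \bigcup_(x in [set` finmap.enum_fset D]) U x by [].
  (* The claim is generalized to every clopen set covered by a finite list of sets [U x]; induction
     on the list splits off the intersection with one [U x] at a time. *)
  have := @clopenT T; move: [set: T] (finmap.enum_fset D) => A s.
  elim: s A => [|x s IH] A cA As.
    have -> : A = set0 by apply/seteqP; split=> // y /As[].
    by apply: (Ugood point) => //; exact: clopen0.
  have cAU : clopen (A `\` U x) by apply: clopenI => //; exact: clopenC.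
  rewrite -(setUIDK A (U x)); apply: goodU => //.
  - exact: clopenI.
  - by apply/disj_setPS => y [[_ ?] [_ /(_ _)]]; exact.
  - by apply: Ugood; [exact: clopenI|exact: subIsetr].
  - apply: IH => // y [Ay nUy]; have [z] := As y Ay.
    by rewrite /= inE => /predU1P[->//|zs] Uz; exists z.
apply/eqP; rewrite -subr_eq0 -normr_le0; apply/ler_addgt0Pr => e e0.
(* Adding 1 keeps the divisor positive when [m setT] is zero. *)
have m1 : 0 < `|m setT| + 1 by rewrite ltr_wpDl.
have := goodT _ (divr_gt0 e0 m1); rewrite /good add0r => /le_trans; apply.
rewrite -mulrA ger_pMr// mulrC ler_pdivrMr// mul1r.
by rewrite (le_trans (ler_norm _))// lerDl.
Qed.

End ClopenGenerated.

(** * Regularity of finite Borel measures *)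

Section RegularFromInner.
Context {T : ptopologicalType} {R : realType}.

Lemma borel_open (U : set T) : open U -> measurable (U : set (borel T)).
Proof. exact: sub_sigma_algebra. Qed.

Lemma borel_closed (C : set T) : closed C -> measurable (C : set (borel T)).
Proof.
move=> cC; rewrite -[C]setCK; apply: (@measurableC _ (borel T)).
by apply: borel_open; exact: closed_openC.
Qed.

(* The open set approximating [A] from outside is the complement of a compact
   set approximating [~` A] from inside. The function [rho] is there for total
   variations, which agree with [nu] on Borel sets only. *)
Lemma regular_measure_inner (nu : {measure set (borel T) -> \bar R})
    (rho : set (borel T) -> \bar R) :
  hausdorff_space T -> (nu setT < +oo)%E ->
  (forall A, measurable A -> rho A = nu A) ->
  (forall (A : set (borel T)) e, measurable A -> 0 < e ->
    exists C : set T, [/\ compact C, C `<=` A & (nu (A `\` C) <= e%:E)%E]) ->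
  regular_measure rho.
Proof.
move=> hT nuoo rhoE inner.
have mC (C : set T) : compact C -> measurable (C : set (borel T)).
  by move=> cC; apply: borel_closed; exact: compact_closed.
have nufin (A : set (borel T)) : measurable A -> (nu A < +oo)%E.
  by move=> mA; apply: le_lt_trans nuoo; apply: le_measure; rewrite ?inE.
have split_nu (A B : set (borel T)) :
    measurable A -> measurable B -> A `<=` B -> (nu B = nu A + nu (B `\` A))%E.
  move=> mA mB AB; rewrite -measureU ?setDIK//; first by rewrite setDUK.
  exact: measurableD.
split=> [C cC|A mA|A mA].
- by rewrite rhoE ?nufin//; exact: mC.
- rewrite rhoE//; apply/eqP; rewrite eq_le; apply/andP; split.
    apply: le_ereal_inf_tmp => _ [U [oU AU] <-].
    rewrite rhoE; last exact: borel_open.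
    by apply: le_measure; rewrite ?inE//; exact: borel_open.
  apply/lee_addgt0Pr => e e0.
  have [C [cC CA nuC]] := inner (~` A) e (measurableC mA) e0.
  apply: ge_ereal_inf; exists (rho (~` C)).
    exists (~` C) => //; split; last by apply: subsetCr.
    by apply: closed_openC; exact: compact_closed.
  have mC' := @measurableC _ (borel T) _ (mC _ cC).
  rewrite rhoE// (split_nu A (~` C))//; last by apply: subsetCr.
  by rewrite leeD2l// setDE setIC -setDE.
- rewrite rhoE//; apply/eqP; rewrite eq_le; apply/andP; split; last first.
    apply: ge_ereal_sup => _ [C [cC CA] <-]; rewrite rhoE; last exact: mC.
    by apply: le_measure; rewrite ?inE//; exact: mC.
  apply/lee_addgt0Pr => e e0; have [C [cC CA nuC]] := inner A e mA e0.
  rewrite (split_nu C A)//; last exact: mC.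
  apply: leeD => //; rewrite -rhoE; last exact: mC.
  by apply: ereal_sup_ubound; exists C.
Qed.

End RegularFromInner.

(** * Riesz representation through the Cantor space *)

Section Riesz.
Context {T : ptopologicalType} {R : realType}.
Variable pi : cantor_space -> T.
Hypotheses (hT : hausdorff_space T) (cpi : continuous pi).
Variable Lam : bfun cantor_space R -> R.
Hypotheses (Lam_lin : scalar Lam)
  (Lam_ge0 : forall f : bfun cantor_space R,
    (forall x, 0 <= f x) -> 0 <= Lam f).

Local Notation X := (g_sigma_algebraType (@clopen cantor_space)).

Let LamD f g : Lam (f + g) = Lam f + Lam g.
Proof. by rewrite -[f]scale1r Lam_lin mul1r scale1r. Qed.

Let LamZ c f : Lam (c *: f) = c * Lam f.
Proof.
have Lam0 : Lam 0 = 0 by apply: (addrI (Lam 0)); rewrite -LamD !addr0.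
by rewrite -[c *: f]addr0 Lam_lin Lam0 addr0.
Qed.


Let LamN f : Lam (- f) = - Lam f. Proof. by rewrite -scaleN1r LamZ mulN1r. Qed.

Let Lam_le (f g : bfun cantor_space R) :
  (forall x, f x <= g x) -> Lam f <= Lam g.
Proof.
move=> fg; rewrite -subr_ge0 -LamN -LamD; apply: Lam_ge0 => x.
by rewrite bfunDE bfunNE subr_ge0.
Qed.

Let m A := Lam (bindic A).

Let m_ge0 A : 0 <= m A.
Proof. by apply: Lam_ge0 => x; rewrite /= indicE ler0n. Qed.

Let indicU (A B : set cantor_space) x : [disjoint A & B] ->
  \1_(A `|` B) x = \1_A x + \1_B x :> R.
Proof.
move=> /disj_setPS AB; rewrite !indicE in_setU.
case: (boolP (x \in A)) => [/set_mem Ax|_]; last by rewrite add0r.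
case: (boolP (x \in B)) => [/set_mem Bx|_]; last by rewrite addr0.
by have := AB x (conj Ax Bx).
Qed.

Let mD A B : [disjoint A & B] -> m (A `|` B) = m A + m B.
Proof.
by move=> AB; rewrite /m -LamD; congr Lam; apply: bfunP => x; exact: indicU.
Qed.

Let clopen_sigma_open : open `<=` <<s @clopen cantor_space >>.
Proof.
move=> U; apply: open_g_sigma_clopen; [exact: cantor_space_compact|
  exact: cantor_space_hausdorff|exact: cantor_zero_dimensional|
  exact: (cantor_clopen_countable R)].
Qed.

Let mpi : measurable_fun [set: X] (pi : X -> borel T).
Proof.
apply: (@measurability _ _ X (borel T) setT _ open erefl) => _ [U oU <-].
rewrite setTI; apply: clopen_sigma_open; move/continuousP : cpi; exact.
Qed.

(** Cover the complement of [A] by clopen sets of total content below its measure plus [e]. The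
    complement of their union is the closed set. *)
Let clopen_approx (mu : {measure set X -> \bar R}) (A : set X) (e : R) :
  (forall A, clopen A -> mu A = (m A)%:E) ->
  (forall A, mu A = ereal_inf
      [set \sum_(k <oo) (m (F k))%:E | F in
        [set F : (set cantor_space)^nat | (forall k, clopen (F k)) /\
                               A `<=` \bigcup_k F k]])%E ->
  (mu setT < +oo)%E -> measurable A -> 0 < e ->
  exists C : set cantor_space,
    [/\ closed C, C `<=` A & (mu (A `\` C) <= e%:E)%E].
Proof.
move=> muE muinf muoo mA e0.
have mA' := @measurableC _ X _ mA.
have fin (B : set X) : measurable B -> mu B \is a fin_num.
  move=> mB; rewrite ge0_fin_numE//; apply: le_lt_trans muoo.
  by apply: le_measure; rewrite ?inE.
have := fin _ mA'; rewrite muinf => /(lb_ereal_inf_adherent e0).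
move=> [_ [F [cF AF] <-]]; rewrite -muinf => Fe.
pose U : set X := \bigcup_k F k.
have mF k : measurable (F k : set X) by exact: sub_sigma_algebra.
have mU : measurable U by exact: bigcupT_measurable.
exists (~` U); split.
- by apply: open_closedC; apply: bigcup_open => k _; exact: (cF k).1.
- by apply: subsetCl.
rewrite setDE setCK setIC -[A]setCK -setDE measureD//; last first.
  by rewrite -ge0_fin_numE// fin.
rewrite leeBlDl ?fin//; last exact: measurableI.
rewrite setIidr// (le_trans _ (ltW Fe))//.
rewrite (eq_eseriesr (fun k _ => esym (muE _ (cF k)))).
exact: (measure_sigma_subadditive mu mF mU).
Qed.

(** The content [m] is extended to a measure [mu], and [nu] is its image under [pi]. Integrals agree
    with [Lam] by [clopen_content_unique], applied to [Lam] of [F] cut off to [A] and to the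
    integral of [f \o pi] over [A]. *)
Theorem riesz_cantor : exists nu : {finite_measure set (borel T) -> \bar R},
  (forall rho : set (borel T) -> \bar R,
    (forall A, measurable A -> rho A = nu A) -> regular_measure rho) /\
  forall (f : T -> R) (F : bfun cantor_space R), continuous f ->
    (forall x, F x = f (pi x)) -> \int[nu]_y f y = Lam F.
Proof.
have [mu [muE muinf]] := clopen_content_extension cantor_space_compact m_ge0 mD.
(* The measure structure of [pushforward] depends on the proof [mpi], which
   cannot be inferred. *)
pose nu0 : {measure set (borel T) -> \bar R} :=
  measure_function_pushforward__canonical__measure_function_Measure mu mpi.
have nu0E A : nu0 A = mu (pi @^-1` A) by [].
have muoo : (mu setT < +oo)%E by rewrite muE ?ltry//; exact: clopenT.
have nu0oo : (nu0 setT < +oo)%E by rewrite nu0E preimage_setT.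
have nu0fin : fin_num_fun nu0.
  move=> A mA; rewrite ge0_fin_numE//; apply: le_lt_trans nu0oo.
  by apply: le_measure; rewrite ?inE.
pose fm := @Measure_isFinite.Build _ (borel T) R nu0 nu0fin.
pose nu : {finite_measure set (borel T) -> \bar R} :=
  HB.pack_for (FiniteMeasure.type (borel T) R) (Measure.sort nu0) fm.
exists nu; split.
  move=> rho rhoE; apply: (regular_measure_inner hT nu0oo rhoE) => A e mA e0.
  have mpiA : measurable (pi @^-1` A : set X).
    by rewrite -[X in measurable X]setTI; exact: mpi.
  have [C [cC CA muC]] := clopen_approx muE muinf muoo mpiA e0.
  have cC' : compact C.
    by apply: subclosed_compact cC cantor_space_compact _.
  have cpiC : compact (pi @` C).
    by apply: continuous_compact => //; exact: continuous_subspaceT.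
  (* The preimage of the image of [C] contains [C], so passing to the image can only reduce the
     error. *)
  exists (pi @` C); split=> //; first by move=> _ [x /CA Ax <-].
  rewrite nu0E; apply: le_trans muC; apply: le_measure; rewrite ?inE.
  - apply: (@measurableD _ X (pi @^-1` A) (pi @^-1` (pi @` C))) => //.
    rewrite -[X in measurable X]setTI; apply: mpi => //.
    by apply: borel_closed; exact: compact_closed.
  - apply: measurableD => //; rewrite -[C]setCK.
    apply: (@measurableC _ X); apply: clopen_sigma_open; exact: closed_openC.
  - by move=> x [Ax nCx]; split=> // Cx; apply: nCx; exists x.
move=> f F cf Ff; pose h : X -> R := f \o pi.
have ch : continuous (f \o pi).
  by move=> x; apply: continuous_comp; [exact: cpi|exact: cf].
have mh : measurable_fun [set: X] h.
  exact: (continuous_g_sigma_measurable clopen_sigma_open ch).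
have mf : measurable_fun [set: borel T] (f : borel T -> R).
  by apply: continuous_g_sigma_measurable cf; exact: sub_sigma_algebra.
have ih (A : set X) : measurable A -> mu.-integrable A (EFin \o h).
  move=> mA; apply: measurable_bounded_integrable => //.
  - by apply: le_lt_trans muoo; apply: le_measure; rewrite ?inE.
  - exact: measurable_funTS.
  - have [M FM] := bfun_bound F; exists M; split; first exact: num_real.
    by move=> N MN x _ /=; rewrite /h /= -Ff (le_trans (FM x)) ?ltW.
have -> : \int[nu]_y f y = \int[mu]_x h x.
  have mf' := (iffRL (measurable_EFinP _ _)) mf.
  congr fine.
  have ih' : mu.-integrable ((pi : X -> borel T) @^-1` setT)
      ((EFin \o (f : borel T -> R)) \o (pi : X -> borel T)).
    exact: (ih setT measurableT).
  exact: (integral_pushforward mpi mf' ih' measurableT).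
(* This exhibits [Lam F] as the value at [setT] of a finitely additive set function. *)
have -> : Lam F = Lam (bmul F (bindic setT)).
  by congr Lam; apply: bfunP => x /=; rewrite indicT mulr1.
apply/esym; apply: (@clopen_content_unique _ _ (f \o pi) m
    (fun A => Lam (bmul F (bindic A))) (fun A => \int[mu]_(x in A) h x)) => //.
- exact: cantor_space_compact.
- exact: cantor_space_hausdorff.
- exact: cantor_zero_dimensional.
- move=> A B cA cB AB.
  have mA : measurable (A : set X) by exact: sub_sigma_algebra.
  have mB : measurable (B : set X) by exact: sub_sigma_algebra.
  split.
  + exact: mD.
  + rewrite -LamD; congr Lam; apply: bfunP => x /=.
    by rewrite indicU// mulrDr.
  + by rewrite Rintegral_setU//; apply: ih; exact: measurableU.
- move=> A a b cA fab.
  have mA : measurable (A : set X) by exact: sub_sigma_algebra.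
  split.
  + rewrite -!LamZ; apply/andP; split; apply: Lam_le => x.
    * change (a * \1_A x <= F x * \1_A x); rewrite indicE.
      case: (boolP (x \in A)) => [/set_mem Ax|_]; last by rewrite !mulr0.
      by rewrite !mulr1 Ff; have /andP[] := fab x Ax.
    * change (F x * \1_A x <= b * \1_A x); rewrite indicE.
      case: (boolP (x \in A)) => [/set_mem Ax|_]; last by rewrite !mulr0.
      by rewrite !mulr1 Ff; have /andP[] := fab x Ax.
  + have muA : mu A \is a fin_num by rewrite muE.
    have ic c : mu.-integrable A (EFin \o cst c).
      apply: measurable_bounded_integrable => //; first by rewrite muE ?ltry.
      by exists `|c|; split; [exact: num_real|move=> N cN x _; exact: ltW].
    have -> : m A = fine (mu A) by rewrite muE.
    rewrite -!Rintegral_cst//; apply/andP; split.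
    * by apply: (le_Rintegral mA (ic a) (ih A mA)) => x /fab/andP[].
    * by apply: (le_Rintegral mA (ih A mA) (ic b)) => x /fab/andP[].
Qed.

End Riesz.

(** * Separating a continuous function from a subspace by two measures *)

Section Separation.
Context {T : ptopologicalType} {R : realType} {W : lmodType R}.
Variables (pi : cantor_space -> T) (ev : W -> T -> R).
Hypotheses (hT : hausdorff_space T) (cpi : continuous pi).
Hypothesis pi_surj : forall y, exists x, pi x = y.
Hypotheses (ev_lin : forall y, scalar (ev^~ y))
  (ev_cont : forall w, continuous (ev w)).

Local Notation bf := (bfun cantor_space R).

(** Working with pairs yields a signed functional as a difference of two positive ones; at
    [(f, - f)] the value is the uniform norm of [f]. *)
Let sup2 (x : bf * bf) := sup (range x.1 `|` range x.2).

Let sup2_has_sup (x : bf * bf) : has_sup (range x.1 `|` range x.2).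
Proof.
split; first by exists (x.1 point); left; exists point.
have [[M fM] [N gN]] := (bfun_bound x.1, bfun_bound x.2).
exists (Num.max M N) => _ [[t _ <-]|[t _ <-]]; rewrite le_max.
- by rewrite (le_trans (ler_norm _) (fM t)).
- by rewrite (le_trans (ler_norm _) (gN t)) orbT.
Qed.

Let sup2_ub (x : bf * bf) t : x.1 t <= sup2 x /\ x.2 t <= sup2 x.
Proof.
by split; apply: ub_le_sup; [exact: (sup2_has_sup x).2| |
  exact: (sup2_has_sup x).2|]; [left|right]; exists t.
Qed.

Let sup2_le (x : bf * bf) c :
  (forall t, x.1 t <= c) -> (forall t, x.2 t <= c) -> sup2 x <= c.
Proof.
move=> x1 x2; apply: ge_sup; first exact: (sup2_has_sup x).1.
by move=> _ [[t _ <-]|[t _ <-]].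
Qed.

Let sup2_sublinear : sublinear sup2.
Proof.
apply: sublinear_build.
- apply/eqP; rewrite eq_le sup2_le//=.
  by have [] := sup2_ub 0 point.
- move=> u v; apply: sup2_le => t; rewrite bfunDE lerD//.
  + by have [] := sup2_ub u t.
  + by have [] := sup2_ub v t.
  + by have [] := sup2_ub u t.
  + by have [] := sup2_ub v t.
- move=> c v c0; apply: sup2_le => t; rewrite bfunZE (ler_wpM2l (ltW c0))//.
  + by have [] := sup2_ub v t.
  + by have [] := sup2_ub v t.
Qed.

Let bounded_comp (h : T -> R) : continuous h ->
  exists M, forall x, `|(h \o pi) x| <= M.
Proof.
move=> ch; have : compact ((h \o pi) @` [set: cantor_space]).
  apply: continuous_compact; last exact: cantor_space_compact.
  apply: continuous_subspaceT => x.
  by apply: continuous_comp; [exact: cpi|exact: ch].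
move=> /compact_bounded[M [_ hM]]; exists (M + 1) => x.
by apply: hM; [rewrite ltrDl|exists x].
Qed.

Let bc h (ch : continuous h) : bf := mk_bfun (bounded_comp ch).
Let bw w := bc (@ev_cont w).

Let bw_lin a u v : bw (a *: u + v) = a *: bw u + bw v.
Proof. by apply: bfunP => x; exact: ev_lin. Qed.

Theorem separating_measures (g : T -> R) (eps : R) : 0 < eps -> continuous g ->
  (forall w, exists y, eps < `|g y - ev w y|) ->
  exists nu1 nu2 : {finite_measure set (borel T) -> \bar R},
    [/\ forall rho : set (borel T) -> \bar R,
          (forall A, measurable A -> rho A = nu1 A) -> regular_measure rho,
        forall rho : set (borel T) -> \bar R,
          (forall A, measurable A -> rho A = nu2 A) -> regular_measure rho,
        forall w, \int[nu1]_y ev w y = \int[nu2]_y ev w y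
      & \int[nu1]_y g y <> \int[nu2]_y g y].
Proof.
move=> eps0 cg far; pose bg := bc cg.
pose emb (f : bf) : bf * bf := (f, - f).
(* Taking [t = 1] and [w = 0] demands [eps <= L (emb bg)]. Taking [t = 0] demands
   [0 <= L (emb (bw w))] for both [w] and [- w], that is, vanishing on [W]. *)
pose G := [set x | exists2 wt : W * R, 0 <= wt.2 &
  x = (emb (wt.2 *: bg + bw wt.1), wt.2 * eps)].
have bw0 : bw 0 = 0.
  by have := bw_lin (-1) 0 0; rewrite scaler0 addr0 scaleN1r addNr.
have cG : convex_cone G.
  split.
  - by exists (0, 0) => //=; rewrite scale0r add0r mul0r bw0 /emb oppr0.
  - move=> _ _ [[w s] /= s0 ->] [[v t] /= t0 ->].
    exists (w + v, s + t); first exact: addr_ge0.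
    rewrite /= mulrDl -[w in RHS]scale1r bw_lin !scale1r scalerDl.
    by rewrite [in RHS]addrACA [in RHS]/emb [in RHS]opprD.
  - move=> c _ c0 [[w s] /= s0 ->]; exists (c *: w, c * s).
      exact: mulr_ge0.
    rewrite /= mulrA -[c *: w]addr0 bw_lin bw0 addr0 -scalerA -scalerDr.
    by rewrite /emb -scalerN.
have Gsup x : G x -> x.2 <= sup2 x.1.
  move=> [[w t] /= + ->] /=; set f := t *: bg + bw w.
  have fsup x' : `|f x'| <= sup2 (emb f).
    by have [? ?] := sup2_ub (emb f) x'; apply/ler_normlP; split.
  rewrite le_eqVlt => /predU1P[<-|t0].
    by rewrite mul0r (le_trans (normr_ge0 _) (fsup point)).
  (* Dividing by [t] turns [t g + w] into [g - s] with [s = - t^-1 w], to which [far] applies. *)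
  have [y] := far (- t^-1 *: w); have [x' <-] := pi_surj y => epsy.
  apply: le_trans (fsup x'); rewrite mulrC -ler_pdivlMr//.
  rewrite (le_trans (ltW epsy))// -[t in _ / t]gtr0_norm// -normf_div.
  rewrite (_ : f x' = t * g (pi x') + ev w (pi x'))//.
  have -> : ev (- t^-1 *: w) (pi x') = - t^-1 * ev w (pi x').
    have ev0 : ev 0 (pi x') = 0.
      by have := ev_lin (pi x') (-1) 0 0; rewrite scaler0 addr0 mulN1r addNr.
    by have := ev_lin (pi x') (- t^-1) w 0; rewrite addr0 ev0 addr0.
  rewrite mulNr opprK mulrDl mulrAC mulfV ?gt_eqF// mul1r.
  by rewrite [ev w _ / t]mulrC.
have [L [L_lin Lsup LG]] := mazur_orlicz sup2_sublinear cG Gsup.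
have L0 : L 0 = 0.
  by have := L_lin (-1) 0 0; rewrite scaler0 addr0 mulN1r addNr.
have LN x : L (- x) = - L x.
  by have := L_lin (-1) x 0; rewrite !addr0 L0 addr0 scaleN1r mulN1r.
(* Being dominated by [sup2], [L] is nonpositive on pairs of nonpositive functions; a change of sign
   gives positivity. *)
have Lpos (x : bf * bf) :
    (forall t, 0 <= x.1 t) -> (forall t, 0 <= x.2 t) -> 0 <= L x.
  move=> x1 x2; rewrite -oppr_le0 -LN; apply: le_trans (Lsup _) _.
  by apply: sup2_le => t; rewrite bfunNE oppr_le0.
have lin1 : scalar (fun f : bf => L (f, 0)).
  move=> a u v; rewrite -L_lin; congr L; congr (_, _) => /=.
  by rewrite scaler0 addr0.
have lin2 : scalar (fun f : bf => L (0, f)).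
  move=> a u v; rewrite -L_lin; congr L; congr (_, _) => /=.
  by rewrite scaler0 addr0.
have [|nu1 [reg1 int1]] := riesz_cantor hT cpi lin1.
  by move=> f f0; apply: Lpos.
have [|nu2 [reg2 int2]] := riesz_cantor hT cpi lin2.
  by move=> f f0; apply: Lpos.
(* The pair [(f, - f)] is [(f, 0) - (0, f)], so [L] at this pair is the difference of the two
   integrals. *)
have intB h (ch : continuous h) :
    \int[nu1]_y h y - \int[nu2]_y h y = L (emb (bc ch)).
  rewrite (int1 h (bc ch) ch)// (int2 h (bc ch) ch)//.
  rewrite -mulN1r addrC -L_lin; congr L; congr (_, _) => /=.
    by rewrite scaler0 add0r.
  by rewrite scaleN1r addr0.
have Lw w : 0 <= L (emb (bw w)).
  have := LG (emb (0 *: bg + bw w), 0 * eps).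
  rewrite scale0r add0r mul0r /=; apply; exists (w, 0) => //=.
  by rewrite scale0r add0r mul0r.
exists nu1, nu2; split=> //.
- move=> w; apply/eqP; rewrite -subr_eq0 (intB _ (@ev_cont w)) eq_le Lw andbT.
  rewrite -oppr_ge0 -LN; have := Lw (- w).
  rewrite -scaleN1r -[_ *: w]addr0 bw_lin bw0 addr0 scaleN1r.
  by rewrite /emb.
- move=> intg; have : eps <= L (emb bg).
    apply: (LG (emb bg, eps)); exists (0, 1) => //=.
    by rewrite bw0 addr0 scale1r mul1r.
  by rewrite /bg -intB intg subrr leNgt eps0.
Qed.

End Separation.

(** * The Jordan decomposition of a positive measure *)

Section ChargeOfMeasure.
Context d {T : measurableType d} {R : realType}.
Variable nu : {finite_measure set T -> \bar R}.

(** The negative part is carried by [N], on whose subsets [nu] is both nonnegative and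
    nonpositive. *)
Lemma jordan_neg_measure (P N : set T)
    (PN : hahn_decomposition (charge_of_finite_measure nu) P N) (A : set T) :
  measurable A -> jordan_neg PN A = 0%E.
Proof.
move=> mA; rewrite jordan_negE cjordan_negE /crestr0 mem_set// /crestr.
have [_ [mN Nneg] _ _] := PN.
have mAN : measurable (A `&` N) by exact: measurableI.
have := Nneg _ mAN (@subIsetr _ _ _).
rewrite /= /charge_of_finite_measure => nuN.
by rewrite (_ : nu (A `&` N) = 0%E) ?oppe0//; apply/eqP; rewrite eq_le nuN /=.
Qed.

Lemma jordan_pos_measure (P N : set T)
    (PN : hahn_decomposition (charge_of_finite_measure nu) P N) (A : set T) :
  measurable A -> jordan_pos PN A = nu A.
Proof.
move=> mA.
have -> : nu A = (jordan_pos PN A + (-1)%:E * jordan_neg PN A)%E.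
  exact: (jordan_decomp PN mA).
by rewrite jordan_neg_measure// mule0 adde0.
Qed.

Lemma total_variation_measure (A : set T) : measurable A ->
  Defs.total_variation (charge_of_finite_measure nu) A = nu A.
Proof.
move=> mA; rewrite /Defs.total_variation /charge_variation.
by rewrite jordan_pos_measure// jordan_neg_measure// adde0.
Qed.

Lemma charge_integral_measure (f : T -> R) :
  charge_integral (charge_of_finite_measure nu) f = \int[nu]_x f x.
Proof.
rewrite /charge_integral /Rintegral.
set PN := hahn_PN _.
have -> : (\int[jordan_neg PN]_x (f x)%:E = \int[mzero]_x (f x)%:E)%E.
  by apply: eq_measure_integral => A mA _; exact: jordan_neg_measure.
have -> : (\int[jordan_pos PN]_x (f x)%:E = \int[nu]_x (f x)%:E)%E.
  by apply: eq_measure_integral => A mA _; exact: jordan_pos_measure.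
by rewrite integral_measure_zero subr0.
Qed.

End ChargeOfMeasure.

(** * Dirac measures and the embedding by kernel columns *)

Section Dirac.
Context {T : ptopologicalType} {R : realType}.

(** Inner approximation is exact: by [[set y]] if [y] lies in the set, by [set0] otherwise. *)
Lemma regular_dirac (y : T) (rho : set (borel T) -> \bar R) :
  hausdorff_space T ->
  (forall A, measurable A -> rho A = \d_(y : borel T) A) -> regular_measure rho.
Proof.
move=> hT rhoE.
apply: (regular_measure_inner (nu := \d_(y : borel T))) => //.
  by rewrite /= diracE mem_set// ltry.
move=> A e mA e0; have [yA|yA] := pselect (A y).
  exists [set y]; split; [exact: compact_set1|by move=> _ ->|].
  by rewrite /= diracE memNset ?lee_fin ?ltW//; case=> _; exact.
exists set0; split; [exact: compact0|exact: sub0set|].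
by rewrite setD0 /= diracE memNset ?lee_fin ?ltW.
Qed.

End Dirac.

(** If the columns agree, the Dirac measures at [y1] and [y2] have the same image under [IKstar],
    hence are equal; evaluation at [[set y1]] then identifies the points. *)
Lemma IKstar_injective_columns {R : realType} {S T : ptopologicalType}
    (mu : {measure set (borel S) -> \bar R}) (K : S * T -> R) (y1 y2 : T) :
  hausdorff_space T -> continuous K -> IKstar_injective mu K ->
  (forall x, K (x, y1) = K (x, y2)) -> y1 = y2.
Proof.
move=> hT cK inj Ky.
pose delta (y : T) : {finite_measure set (borel T) -> \bar R} :=
  \d_(y : borel T).
have reg (y : T) : regular_charge (charge_of_finite_measure (delta y)).
  apply: (regular_dirac hT) => A mA; exact: total_variation_measure.
have int (x : S) (y : T) :
    charge_integral (charge_of_finite_measure (delta y)) (fun y => K (x, y)) =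
    K (x, y).
  rewrite charge_integral_measure /Rintegral integral_dirac//.
    by rewrite diracT mul1e.
  apply/measurable_EFinP; apply: continuous_g_sigma_measurable.
    exact: sub_sigma_algebra.
  move=> z; apply: (@continuous_comp _ _ _ (fun z => (x, z)) K); last exact: cK.
  by apply: cvg_pair; [exact: cvg_cst|exact: cvg_id].
have eq_dirac : delta y1 [set y1] = delta y2 [set y1].
  apply: (inj _ _ (reg y1) (reg y2)) => [A mA|].
    by apply: eq_integral => x _; congr EFin; rewrite !int.
  apply: borel_closed.
  exact: accessible_closed_set1 (hausdorff_accessible hT) _.
apply: contrapT => y12; move: eq_dirac; rewrite /= !diracE mem_set//.
by rewrite memNset => [[/eqP]|/= y21]; [rewrite oner_eq0|exact/y12/esym].
Qed.

(** The topology [W] induced by [c] is compact, Hausdorff and given by a pseudometric, so the Cantor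
    space maps onto it. A compact topology finer than a Hausdorff one equals it, so the map is also
    continuous into [T]. *)
Lemma cantor_surj_embedding {R : realType} {T : ptopologicalType}
    {V : normedModType R} (c : T -> V) :
  compact [set: T] -> continuous c -> injective c ->
  exists pi : cantor_space -> T, continuous pi /\ forall y, exists x, pi x = y.
Proof.
move=> cT cc ci; pose W := initial_topology c.
have id_cont : continuous (id : T -> W).
  by apply: continuous_comp_initial; exact: cc.
have cW : compact [set: W].
  have -> : [set: W] = (id : T -> W) @` [set: T].
    by apply/seteqP; split=> // y _; exists y.
  by apply: continuous_compact cT; exact: continuous_subspaceT.
have hW : hausdorff_space W.
  rewrite open_hausdorff => x y xy.
  have : c x != c y by apply: contra_neq xy => /ci.
  have := @norm_hausdorff _ V; rewrite open_hausdorff => /[apply].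
  move=> [[A B] /= [/set_mem xA /set_mem yB] [oA oB /eqP AB]].
  exists (c @^-1` A, c @^-1` B); first by split; exact: mem_set.
  split; [by exists A|by exists B|].
  by rewrite -preimage_setI AB preimage_set0.
pose W0 : pseudoMetricType R := initial_topology c.
pose W1 : pseudoPMetricType R :=
  HB.pack (initial_topology c) (PseudoMetric.class W0).
have [f cf] := @cantor_surj R W1 cW hW.
exists (f : cantor_space -> T); split; last first.
  by move=> y; have [x _ fx] := @surj _ _ _ _ f y I; exists x.
(* A closed set of [T] is compact, remains so in the coarser topology [W], and is closed there
   because [W] is Hausdorff. *)
apply/continuous_closedP => A cA; move/continuous_closedP : cf; apply.
have -> : A = (id : T -> W) @` A by rewrite image_id.
apply: compact_closed hW _; apply: continuous_compact.
  exact: continuous_subspaceT.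
exact: subclosed_compact cA cT _.
Qed.

(** * Uniform density of the dual space *)

Theorem proposition2p28 (R : realType) (Omega Omega' : ptopologicalType)
  (compactO : compact [set: Omega]) (hausdorffO : hausdorff_space Omega)
  (compactO' : compact [set: Omega']) (hausdorffO' : hausdorff_space Omega')
  (mu : {measure set (borel Omega) -> \bar R}) (regmu : regular_measure mu)
  (mu' : {measure set (borel Omega') -> \bar R}) (regmu' : regular_measure mu')
  (q : \bar R) (q1 : (1 <= q)%E)
  (K : Omega * Omega' -> R) (contK : continuous K)
  (B : @two_sided_rkbs _ _ (borel Omega) (borel Omega') R K)
  (cont_col : continuous (rkbs_col B : Omega' -> rkbs_space B))
  (Lq_row : ((fun x : borel Omega => `|rkbs_row B x|) : borel Omega -> R)
              \in Lfun mu q)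
  (IK_inj : IKstar_injective mu K) :
  forall (eps : R) (g : Omega' -> R), 0 < eps -> continuous g ->
    exists s : rkbs_dual B,
      (uniform_norm (fun y : Omega' => (g y - rkbs_dual_ev s y)%R) <= eps%:E)%E.
Proof.
move=> eps g eps0 cg.
have [ev_lin _ _] := rkbs_dual_functions B.
have [_ iso_lin _ _] := rkbs_isoP B.
have col_inj : injective (rkbs_col B : Omega' -> rkbs_space B).
  move=> y1 y2 y12; apply: (IKstar_injective_columns hausdorffO' contK IK_inj).
  move=> x; have := rkbs_colE B y1; rewrite y12 rkbs_colE => /(congr1 (@^~ x)).
  by move=> ->.
have ev_cont (s : rkbs_dual B) : continuous (rkbs_dual_ev s : Omega' -> R).
  (* Reproduction in the dual factors [s] through the continuous column map. *)
  have -> : rkbs_dual_ev s = rkbs_iso s \o rkbs_col B.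
    by apply/funext => y; rewrite /= rkbs_dual_reproducing.
  move=> y; apply: continuous_comp; first exact: cont_col.
  exact: (iso_lin s).2.
have [pi [cpi pi_surj]] := cantor_surj_embedding compactO' cont_col col_inj.
apply: contrapT => /forallNP far.
have {}far (s : rkbs_dual B) :
    exists y : Omega', eps < `|g y - rkbs_dual_ev s y|.
  move: (far s) => /negP; rewrite -ltNge => /ereal_sup_gt[_ [y _ <-]].
  by rewrite lte_fin; exists y.
have [nu1 [nu2 [reg1 reg2 int_ev int_g]]] :=
  separating_measures hausdorffO' cpi pi_surj ev_lin ev_cont eps0 cg far.
have reg (nu : {finite_measure set (borel Omega') -> \bar R}) :
    (forall rho : set (borel Omega') -> \bar R,
      (forall A, measurable A -> rho A = nu A) -> regular_measure rho) ->
    regular_charge (charge_of_finite_measure nu).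
  by apply => A mA; exact: total_variation_measure.
(* Equality of the two measures contradicts [int_g]. It follows from injectivity: [K(x,.)] is the
   dual element [rkbs_row B x], so both measures give the same inner integral in [IKstar] at every
   [x]. *)
apply: int_g; congr fine; apply: eq_measure_integral => A mA _.
apply: (IK_inj _ _ (reg _ reg1) (reg _ reg2)) => // {mA}A mA.
apply: eq_integral => x _; congr EFin.
by rewrite !charge_integral_measure -(rkbs_rowE B x); exact: int_ev.
Qed.
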